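(* For every integer $s \geq 2$, there exists a graph $G$ such that $G \stackrel{2}{\to} K_3$ but $G[s] \stackrel{2}{\not\to} K_3[2]$. That is, every $2$-colouring of the edges of $G$ contains a monochromatic copy of $K_3$, but there is a $2$-colouring of the edges of $G[s]$ which contains no monochromatic copy of $K_3[2]$.
   Context: For graphs $G,H$ and $r\in\mathbb{N}$, write $G \stackrel{r}{\to} H$ if every $r$-colouring of the edges of $G$ contains a monochromatic copy of $H$, and $G \stackrel{r}{\not\to} H$ if this is not the case. For a graph $H$ and $t\in\mathbb{N}$, the $t$-blowup $H[t]$ is the graph obtained from $H$ by replacing each vertex of $H$ by an independent set of size $t$ and replacing every edge of $H$ by a complete bipartite graph $K_{t,t}$ between the corresponding parts. $K_3$ denotes the triangle. *)

(* Defs.v *)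
From mathcomp Require Import all_boot.

Set Implicit Arguments.
Unset Strict Implicit.
Unset Printing Implicit Defensive.

(** Finite simple graphs. *)
Record sgraph := SGraph {
  vertex :> finType;
  adj : rel vertex;
  adj_sym : symmetric adj;
  adj_irr : irreflexive adj
}.

Section Complete.
Variable n : nat.
Definition complete_adj : rel 'I_n := fun u v => u != v.
Lemma complete_sym : symmetric complete_adj.
Proof. by move=> u v; rewrite /complete_adj eq_sym. Qed.
Lemma complete_irr : irreflexive complete_adj.
Proof. by move=> u; rewrite /complete_adj eqxx. Qed.
Definition complete : sgraph := SGraph complete_sym complete_irr.
End Complete.

Section Blowup.
Variables (H : sgraph) (t : nat).
(* The independent set replacing the vertex v is {v} x 'I_t. *)
Definition blowup_adj : rel (H * 'I_t) := fun x y => adj x.1 y.1.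
Lemma blowup_sym : symmetric blowup_adj.
Proof. by move=> x y; rewrite /blowup_adj adj_sym. Qed.
Lemma blowup_irr : irreflexive blowup_adj.
Proof. by move=> x; rewrite /blowup_adj adj_irr. Qed.
Definition blowup : sgraph := SGraph blowup_sym blowup_irr.
End Blowup.

(* Copies are subgraphs, not necessarily induced. *)
Definition is_copy (H G : sgraph) (f : H -> G) : Prop :=
  injective f /\ forall u v : H, adj u v -> adj (f u) (f v).

(* An edge {u, v} is the set [set u; v].  A colouring is given as a total
   function on vertex sets; its values at non-edges are never inspected,
   so for r > 0 this is the same as colouring the edge set only. *)
Definition colouring (r : nat) (G : sgraph) : Type := {set G} -> 'I_r.

Definition monochromatic (r : nat) (H G : sgraph) (c : colouring r G)
    (f : H -> G) : Prop :=
  exists k : 'I_r, forall u v : H, adj u v -> c [set f u; f v] = k.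

Definition arrows (r : nat) (G H : sgraph) : Prop :=
  forall c : colouring r G,
    exists f : H -> G, is_copy f /\ monochromatic c f.

(* Main.v *)
Require Import Defs.
From mathcomp Require Import all_boot.
From mathcomp Require Import boolp.

(** Consider graphs built by adding vertices one at a time, where each new vertex
    u is joined to a splittable set N of earlier ones: N has s vertex 2-colourings
    such that every edge of N is monochromatic in at most one of them.

    If such a graph arrows the triangle, take the first moment at which it does, and
    let u be the vertex added then.  Colour the graph without u avoiding
    monochromatic triangles, copy this colouring to the blowup, and let the i-th
    copy of u use the i-th of the s colourings of its link.  Every monochromatic
    triangle contains a copy of u, and each triangle of the base graph is
    monochromatic over at most one copy of u.  Hence no octahedron,
    that is, no K_3[2], is monochromatic, wherever its vertices lie
    (initial_graph_blowup).

    So it suffices that some graph built in this way arrows the triangle.  There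
    is an infinite graph of this kind in which every finite splittable set is the
    link of arbitrarily late vertices (universal_graph).  If no initial segment
    arrowed the triangle, compactness would give a colouring of the whole graph
    without monochromatic triangles (triangle_free_limit).

    In such a colouring, the colours of the edges from a new vertex to its link N
    solve a 2-satisfiability problem given by the colours inside N.  A long odd
    cycle that alternates in colour except at one vertex forces the colour at that
    vertex and is splittable.  Such cycles exist: alternating paths of any length
    are grown by joining new vertices to both ends of an edge, because one of the
    two new edges must avoid the colour of that edge (supply_step), and a new
    vertex closes a path to a cycle (close_cycle).  Two adjacent vertices with the
    same forced colour cannot be joined in this colour, since a vertex joined to
    both gadgets would complete a monochromatic triangle (forces_clash).  Playing
    the two forced colours against each other leads to a contradiction (forcer,
    tension_exists, no_avoiding_colouring). *)

Set Implicit Arguments.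
Unset Strict Implicit.
Unset Printing Implicit Defensive.

(** * Splittable links *)

(** A vertex joined to N has s copies in the blowup, and the i-th copy may
    colour its edges to N by f _ i.  Splittability says that no edge of N
    closes a monochromatic triangle with two different copies.  Proper
    2-colourings show that bipartite sets are splittable; long odd cycles are
    splittable too, since the i-th colouring can put its single defect on the
    i-th edge. *)
Definition splittable (s : nat) (A : rel nat) (N : seq nat) : Prop :=
  exists f : nat -> nat -> bool, forall y z, y \in N -> z \in N -> A y z ->
    forall i j, i < s -> j < s -> f y i = f z i -> f y j = f z j -> i = j.

Lemma eq_splittable s (A A' : rel nat) N :
    {in N &, A =2 A'} -> splittable s A N -> splittable s A' N.
Proof. by move=> eqA [f fP]; exists f => y z yN zN; rewrite -eqA //; apply: fP. Qed.

Lemma sub_splittable s A N N' :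
  {subset N' <= N} -> splittable s A N -> splittable s A N'.
Proof. by move=> sub [f fP]; exists f => y z /sub yN /sub zN; apply: fP. Qed.

Lemma splittable_nil s A : splittable s A [::].
Proof. by exists (fun _ _ => true). Qed.

Lemma injective_unbounded (g : nat -> nat) :
  injective g -> forall B, exists k, B <= g k.
Proof.
move=> gI B; apply: contrapT => /forallNP noB.
have : size [seq g k | k <- iota 0 B.+1] <= size (iota 0 B).
  apply: uniq_leq_size => [|_ /mapP[k _ ->]]; first by rewrite map_inj_uniq ?iota_uniq.
  by rewrite mem_iota add0n ltnNge; apply/negP/noB.
by rewrite size_map !size_iota ltnn.
Qed.

(** * A graph realising every splittable extension *)

(** Vertices are natural numbers, and a vertex is specified by its link in the
    set of smaller vertices.  Numbers code pairs of a finite set N and an index,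
    so every N is proposed infinitely often; a proposal is accepted exactly when
    it is splittable in the graph built so far. *)
Section UniversalGraph.

Variable s : nat.

Definition proposed_link (n : nat) : seq nat :=
  if unpickle n is Some p then [seq v <- (p : seq nat * nat).1 | v < n] else [::].

Definition graph_of (L : seq (seq nat)) : rel nat := fun x y =>
  (y < x) && (y \in nth [::] L x) || (x < y) && (x \in nth [::] L y).

Fixpoint links (n : nat) : seq (seq nat) :=
  if n is m.+1 then
    rcons (links m) (if `[< splittable s (graph_of (links m)) (proposed_link m) >]
                     then proposed_link m else [::])
  else [::].

Definition universal_graph : rel nat := fun x y => graph_of (links (maxn x y).+1) x y.

Lemma size_links n : size (links n) = n.
Proof. by elim: n => //= n IHn; rewrite size_rcons IHn. Qed.

Lemma nth_links n m x : x < n -> n <= m -> nth [::] (links m) x = nth [::] (links n) x.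
Proof.
move=> ltxn; elim: m => [|m IHm]; first by rewrite leqn0 => /eqP n0; rewrite n0 in ltxn.
rewrite leq_eqVlt => /predU1P[-> //|]; rewrite ltnS => lenm.
by rewrite /= nth_rcons size_links (leq_trans ltxn lenm) IHm.
Qed.

Lemma universal_graphE n x y : x < n -> y < n ->
  universal_graph x y = graph_of (links n) x y.
Proof.
move=> xn yn; rewrite /universal_graph /graph_of.
have le : (maxn x y).+1 <= n by rewrite gtn_max xn yn.
by rewrite -!(@nth_links (maxn x y).+1 n) // ltnS ?leq_maxl ?leq_maxr.
Qed.

Lemma universal_graph_sym : symmetric universal_graph.
Proof. by move=> x y; rewrite /universal_graph /graph_of maxnC orbC. Qed.

Lemma universal_graph_irr : irreflexive universal_graph.
Proof. by move=> x; rewrite /universal_graph /graph_of ltnn. Qed.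

Lemma universal_graph_back u v : v < u ->
  universal_graph u v = (v \in nth [::] (links u.+1) u).
Proof.
move=> vu; rewrite (@universal_graphE u.+1) ?ltnS ?(ltnW vu) // /graph_of vu /=.
by rewrite ltnNge (ltnW vu) orbF.
Qed.

Lemma proposed_link_lt u v : v \in proposed_link u -> v < u.
Proof. by rewrite /proposed_link; case: unpickle => // p; rewrite mem_filter => /andP[]. Qed.

Lemma universal_graph_splittable u :
  splittable s universal_graph [seq v <- iota 0 u | universal_graph u v].
Proof.
set N := [seq v <- _ | _].
have NE v : v \in N -> v < u /\ v \in nth [::] (links u.+1) u.
  by rewrite mem_filter mem_iota add0n andbC => /andP[vu]; rewrite universal_graph_back.
rewrite /= nth_rcons size_links ltnn eqxx in NE.
case: asboolP NE => [sp|_] NE; last first.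
  by apply: sub_splittable (splittable_nil _ _) => v /NE[].
apply: sub_splittable (eq_splittable _ sp) => [v /NE[]//|x y xN yN].
by rewrite (@universal_graphE u) ?proposed_link_lt.
Qed.

(** The index in the coded pair is what allows the new vertex to lie beyond any
    given bound. *)
Lemma universal_graph_extension N B : splittable s universal_graph N ->
  exists u, [/\ B <= u, forall v, v \in N -> v < u
              & forall v, v < u -> universal_graph u v = (v \in N)].
Proof.
move=> sp; pose C := maxn B (\max_(v <- N) v).+1.
have pI : injective (fun k => pickle (N, k : nat)).
  by move=> k l /(pcan_inj pickleK) [].
have [k Ck] := injective_unbounded pI C.
set u := pickle (N, k) in Ck; exists u.
have ltN v : v \in N -> v < u.
  move=> vN; apply: leq_trans Ck; rewrite leq_max ltnS; apply/orP; right.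
  by rewrite (big_rem v) //= leq_maxl.
have uE : proposed_link u =i N.
  move=> v; rewrite /proposed_link pickleK mem_filter.
  by case: (boolP (v \in N)) => [/ltN ->|] //=; rewrite andbF.
split=> //; first by apply: leq_trans Ck; rewrite leq_maxl.
move=> v vu; rewrite universal_graph_back //= nth_rcons size_links ltnn eqxx.
case: asboolP => [_|[]]; first exact: uE.
apply: sub_splittable (eq_splittable _ sp) => [x|x y xN yN]; first by rewrite uE.
by rewrite (@universal_graphE u) ?ltN.
Qed.

End UniversalGraph.

(** * Colourings of initial segments and compactness *)

(** The colour of an edge is read off with its smaller end first, so that no
    symmetry has to be imposed on k. *)
Definition triangle_free_colouring (A : rel nat) (m : nat) (k : nat -> nat -> bool) :=
  forall x y z, x < y -> y < z -> z < m -> A x y -> A x z -> A y z ->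
    ~ (k x y = k x z /\ k x y = k y z).

Definition unordered (k : nat -> nat -> bool) : nat -> nat -> bool :=
  fun x y => k (minn x y) (maxn x y).

Lemma unordered_sym k x y : unordered k x y = unordered k y x.
Proof. by rewrite /unordered minnC maxnC. Qed.

Lemma unordered_no_mono (A : rel nat) m k : symmetric A -> irreflexive A ->
  triangle_free_colouring A m k -> forall x y z, x < m -> y < m -> z < m ->
  A x y -> A x z -> A y z ->
  ~ (unordered k x y = unordered k x z /\ unordered k x y = unordered k y z).
Proof.
move=> Asym Airr kP x y z xm ym zm Axy Axz Ayz [].
have tri a b c e : a < b -> b < c -> c < m -> A a b -> A a c -> A b c ->
    k a b = e -> k a c = e -> k b c = e -> False.
  by move=> ab bc cm Aab Aac Abc e1 e2 e3; apply: (kP a b c) => //; rewrite e1 e2 e3.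
set e := unordered k x y => /esym exz /esym eyz; have exy : unordered k x y = e by [].
clearbody e; move: exy exz eyz; rewrite /unordered /minn /maxn.
case: (ltngtP x y) => [xy|xy|xy]; last by rewrite xy Airr in Axy.
all: case: (ltngtP x z) => [xz|xz|xz]; last by rewrite xz Airr in Axz.
all: case: (ltngtP y z) => [yz|yz|yz] k1 k2 k3; last by rewrite yz Airr in Ayz.
all: first [ by case: (tri x y z e); rewrite // Asym | by case: (tri x z y e); rewrite // Asym
           | by case: (tri y x z e); rewrite // Asym | by case: (tri y z x e); rewrite // Asym
           | by case: (tri z x y e); rewrite // Asym | by case: (tri z y x e); rewrite // Asym
           | by have := ltn_trans xy (ltn_trans yz xz); rewrite ltnn
           | by have := ltn_trans xz (ltn_trans yz xy); rewrite ltnn ].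
Qed.

(** Koenig's lemma for bit sequences: the prefix is extended by a bit that keeps
    it a prefix of infinitely many of the sequences b m. *)
Lemma compactness (b : nat -> nat -> bool) :
  exists c : nat -> bool, forall n M, exists2 m, M <= m & forall i, i < n -> b m i = c i.
Proof.
pose often (p : seq bool) := forall M, exists2 m, M <= m &
  forall i, i < size p -> b m i = nth false p i.
pose fix p n := if n is n'.+1 then rcons (p n') `[< often (rcons (p n') true) >] else [::].
have size_p n : size (p n) = n by elim: n => //= n IHn; rewrite size_rcons IHn.
have often_p n : often (p n).
  elim: n => [|n IHn] M /=; first by exists M.
  case: asboolP M => // /existsNP[M0 noM0] M.
  have [m lem mP] := IHn (maxn M0 M); move: lem; rewrite geq_max => /andP[leM0 leM].
  exists m => // i; rewrite size_rcons ltnS leq_eqVlt nth_rcons size_p => /predU1P[->|lt].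
    rewrite ltnn eqxx; apply: contra_notF noM0 => bmn; exists m => // j.
    rewrite size_rcons ltnS leq_eqVlt nth_rcons size_p => /predU1P[->|lt].
      by rewrite ltnn eqxx.
    by rewrite lt mP ?size_p.
  by rewrite lt mP ?size_p.
have p_nth n m i : i < n -> n <= m -> nth false (p m) i = nth false (p n) i.
  move=> ltin; elim: m => [|m IHm]; first by rewrite leqn0 => /eqP n0; rewrite n0 in ltin.
  rewrite leq_eqVlt => /predU1P[-> //|]; rewrite ltnS => lenm.
  by rewrite /= nth_rcons size_p (leq_trans ltin lenm) IHm.
exists (fun i => nth false (p i.+1) i) => n M.
have [m leMm mP] := often_p n M; exists m => // i lt.
by rewrite mP ?size_p // (@p_nth i.+1 n).
Qed.

Lemma triangle_free_limit A :
  (forall m, exists k, triangle_free_colouring A m k) ->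
  exists k, forall m, triangle_free_colouring A m k.
Proof.
move=> /choice[k kP].
have [c cP] := compactness (fun m i => if unpickle i is Some p then k m p.1 p.2 else false).
exists (fun x y => c (pickle (x, y))) => m x y z xy yz zm.
pose n := (maxn (pickle (x, y)) (maxn (pickle (x, z)) (pickle (y, z)))).+1.
have [m' lem m'P] := cP n m.
have kE u v : pickle (u, v) < n -> c (pickle (u, v)) = k m' u v.
  by move=> /m'P; rewrite pickleK.
rewrite !kE ?ltnS ?leq_max ?leqnn ?orbT //.
by apply: kP => //; apply: leq_trans lem.
Qed.

(** * From a Ramsey initial segment to the blowup *)

Lemma set2_eqE (T : finType) (a b x y : T) :
  [set a; b] = [set x; y] -> (a = x /\ b = y) \/ (a = y /\ b = x).
Proof.
move=> E.
have : a \in [set x; y] by rewrite -E set21.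
have : b \in [set x; y] by rewrite -E set22.
have : x \in [set a; b] by rewrite E set21.
have : y \in [set a; b] by rewrite E set22.
rewrite !inE => /orP[]/eqP-> /orP[]/eqP-> /orP[]/eqP e /orP[]/eqP e'; auto.
Qed.

Lemma colouring_of_symmetric (G : sgraph) (g : G -> G -> bool) :
  (forall x y, g x y = g y x) ->
  exists c : colouring 2 G, forall x y, c [set x; y] = inord (g x y).
Proof.
move=> gC.
exists (fun S => if [pick p : G * G | S == [set p.1; p.2]] is Some p
                 then inord (g p.1 p.2) else ord0) => x y.
case: pickP => [[a b] /= /eqP/set2_eqE[[-> ->]|[-> ->]]|/(_ (x, y))]; rewrite 1?gC //=.
by rewrite eqxx.
Qed.

Section Blowups.

Variables (s : nat) (A : rel nat).
Hypotheses (Asym : symmetric A) (Airr : irreflexive A).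
Hypothesis back_link_splittable : forall u, splittable s A [seq v <- iota 0 u | A u v].

Definition initial_adj n : rel 'I_n := fun x y => A x y.

Definition initial_graph n : sgraph :=
  @SGraph 'I_n (@initial_adj n) (fun x y => Asym x y) (fun x => Airr x).

Lemma initial_graph_arrows n :
  (forall k, ~ triangle_free_colouring A n.+1 k) ->
  arrows 2 (initial_graph n.+1) (complete 3).
Proof.
move=> noK c.
pose k x y := c [set inord x; inord y] == ord0 :> 'I_2.
have [x [y [z [xy [yz [zn [Axy [Axz [Ayz [k1 k2]]]]]]]]]] :
  exists x y z, x < y /\ y < z /\ z < n.+1 /\ A x y /\ A x z /\ A y z /\
    (k x y = k x z /\ k x y = k y z).
  apply: contrapT => no; apply: (noK k) => x y z xy yz zn Axy Axz Ayz kk.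
  by case: no; exists x, y, z; do 6! split=> //.
have yn := ltn_trans yz zn; have xn := ltn_trans xy yn.
have twoE (a b : 'I_2) : (a == ord0) = (b == ord0) -> a = b.
  by case: a b => [[|[|[]]] //= ?] [[|[|[]]] //= ?] _; apply: val_inj.
move/twoE in k1; move/twoE in k2.
pose F (i : 'I_3) : 'I_n.+1 := nth ord0 [:: inord x; inord y; inord z] i.
have AF i j : i != j -> A (F i) (F j).
  by case: i j => [[|[|[]]] // ?] [[|[|[]]] // ?] // _; rewrite /F /= !inordK // Asym.
exists F; split; first split=> //.
  by move=> i j eqF; apply/eqP; apply: contraT => /AF; rewrite eqF Airr.
exists (c [set inord x; inord y]) => i j.
case: i j => [[|[|[]]] // ?] [[|[|[]]] // ?] //= _; rewrite /F /= ?k1 ?k2 //.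
- by rewrite setUC k1.
- by rewrite setUC -k1.
- by rewrite setUC -k2 k1.
Qed.

(** The last vertex n of the graph is the apex.  Edges away from it keep the
    colour given by k, whatever the copies of their ends, and the i-th copy of the
    apex uses the i-th colouring of a splitting of its link.  All monochromatic
    triangles then contain a copy of n.  A monochromatic octahedron has eight
    monochromatic faces; copies of n are pairwise non-adjacent, hence lie in one
    part, and that part consists of two copies of n.  A face on each of them, with
    the other two vertices in common, contradicts splittability. *)
Lemma initial_graph_blowup n k : triangle_free_colouring A n k ->
  ~ arrows 2 (blowup (initial_graph n.+1) s) (blowup (complete 3) 2).
Proof.
move=> kP arr; have [f fP] := back_link_splittable n.
pose V := blowup (initial_graph n.+1) s.
pose base (x : V) : nat := x.1.
pose copy (x : V) : nat := x.2.
pose g (x y : V) :=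
  if base x == n then f (base y) (copy x) else
  if base y == n then f (base x) (copy y) else
  unordered k (base x) (base y).
(* On pairs with equal base, which are not edges, g need not be symmetric. *)
pose g' x y := if base x == base y then false else g x y.
have g'C x y : g' x y = g' y x.
  rewrite /g' eq_sym /g unordered_sym.
  have [//|] := eqVneq (base y) (base x).
  have [->|] := eqVneq (base x) n; last by [].
  by case: eqVneq.
have [c cE] := colouring_of_symmetric g'C.
have [F [[Finj Fhom] [kap Fmono]]] := arr c.
have baseA x y : adj x y -> A (base (F x)) (base (F y)) by move/Fhom.
have neq x y : adj x y -> base (F x) <> base (F y).
  by move=> /baseA Axy e; rewrite e Airr in Axy.
have gE x y : adj x y -> g (F x) (F y) = (kap == ord_max).
  move=> xy; have := Fmono x y xy; rewrite cE /g'; case: eqP => [/(neq _ _ xy)//|_ <-].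
  by rewrite -val_eqE /= inordK; case: (g _ _).
have lts (x : V) : copy x < s by exact: ltn_ord.
have base_lt x : base (F x) != n -> base (F x) < n.
  by move=> ne; rewrite ltn_neqAle ne -ltnS; exact: ltn_ord.
have adjP (p q : blowup (complete 3) 2) : p.1 != q.1 -> adj p q by [].
have meets_apex (p q r : blowup (complete 3) 2) : adj p q -> adj p r -> adj q r ->
    [|| base (F p) == n, base (F q) == n | base (F r) == n].
  move=> pq pr qr; apply: contraT; rewrite !negb_or => /and3P[pn qn rn].
  have kE x y : adj x y -> base (F x) != n -> base (F y) != n ->
      unordered k (base (F x)) (base (F y)) = (kap == ord_max).
    by move=> xy xn yn; rewrite -(gE x y xy) /g (negPf xn) (negPf yn).
  case: (unordered_no_mono Asym Airr kP (base_lt _ pn) (base_lt _ qn) (base_lt _ rn)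
           (baseA _ _ pq) (baseA _ _ pr) (baseA _ _ qr)).
  by rewrite !kE.
(* A part with one vertex over the apex would have both of them there. *)
have apex_part (t t' t'' : 'I_3) : t != t' -> t != t'' -> t' != t'' ->
    base (F (t, ord0)) == n -> False.
  move=> tt' tt'' t't'' t0n.
  have off (t0 : 'I_3) i : t != t0 -> base (F (t0, i)) != n.
    by move=> ne; rewrite -(eqP t0n) eq_sym; apply/eqP/neq/adjP.
  have t1n : base (F (t, ord_max)) == n.
    have := @meets_apex (t, ord_max) (t', ord0) (t'', ord0).
    by rewrite (negPf (off t' _ _)) // (negPf (off t'' _ _)) // !orbF; apply; apply: adjP.
  have inL (t0 : 'I_3) : t != t0 -> base (F (t0, ord0)) \in [seq v <- iota 0 n | A n v].
    move=> ne; rewrite mem_filter mem_iota /= add0n base_lt ?off // andbT -(eqP t0n).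
    by apply: baseA; apply: adjP.
  have e0 (t0 : 'I_3) i : t != t0 -> base (F (t, i)) == n ->
      f (base (F (t0, ord0))) (copy (F (t, i))) = (kap == ord_max).
    by move=> ne tin; rewrite -(gE (t, i) (t0, ord0)) ?/g ?tin //; apply: adjP.
  have eqc : copy (F (t, ord0)) = copy (F (t, ord_max)).
    apply: (fP (base (F (t', ord0))) (base (F (t'', ord0)))); rewrite ?inL ?e0 //.
    by apply: baseA; apply: adjP.
  have : F (t, ord0) = F (t, ord_max).
    have e1 : (F (t, ord0)).1 = (F (t, ord_max)).1.
      by apply/val_inj; exact: etrans (eqP t0n) (esym (eqP t1n)).
    have e2 : (F (t, ord0)).2 = (F (t, ord_max)).2 by exact: val_inj eqc.
    by case: (F _) (F _) e1 e2 => [? ?] [? ?] /= -> ->.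
  by move=> /Finj.
pose t0 : 'I_3 := inord 0; pose t1 : 'I_3 := inord 1; pose t2 : 'I_3 := inord 2.
have ne01 : t0 != t1 by rewrite -val_eqE /= !inordK.
have ne02 : t0 != t2 by rewrite -val_eqE /= !inordK.
have ne12 : t1 != t2 by rewrite -val_eqE /= !inordK.
have /or3P[] := @meets_apex (t0, ord0) (t1, ord0) (t2, ord0) ne01 ne02 ne12.
- exact: (apex_part t0 t1 t2).
- by apply: (apex_part t1 t0 t2); rewrite // eq_sym.
- by apply: (apex_part t2 t0 t1); rewrite // eq_sym.
Qed.

(** Minimality is what makes one apex suffice: the shortest Ramsey initial segment
    minus its last vertex has a colouring without monochromatic triangles. *)
Lemma initial_graph_theorem m : (forall k, ~ triangle_free_colouring A m k) ->
  exists G : sgraph,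
    arrows 2 G (complete 3) /\ ~ arrows 2 (blowup G s) (blowup (complete 3) 2).
Proof.
pose ramsey m := `[< forall k, ~ triangle_free_colouring A m k >].
move=> mP; have exm : exists m, ramsey m by exists m; apply/asboolP.
case: (ex_minnP exm) => -[|n] /asboolP nP minn.
  by case: (nP (fun _ _ => true)) => x y z _ _; rewrite ltn0.
exists (initial_graph n.+1); split; first exact: initial_graph_arrows.
have /existsNP[k /contrapT kP] : ~ forall k, ~ triangle_free_colouring A n k.
  by move=> nk; have := minn n; rewrite ltnn => /(_ (asboolT nk)).
exact: initial_graph_blowup kP.
Qed.

End Blowups.

(** * Forced colours *)

(** From here on col is a colouring without monochromatic triangles of a graph
    realising every splittable extension; such a colouring is refuted. *)
Section Refutation.

Variables (s : nat) (A : rel nat) (col : nat -> nat -> bool).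
Hypotheses (Asym : symmetric A) (Airr : irreflexive A).
Hypothesis col_sym : forall x y, col x y = col y x.
Hypothesis no_mono : forall x y z, A x y -> A x z -> A y z ->
  ~ (col x y = col x z /\ col x y = col y z).
Hypothesis extension : forall N B, splittable s A N ->
  exists u, [/\ B <= u, forall v, v \in N -> v < u
              & forall v, v < u -> A u v = (v \in N)].

(** The condition on the colours x of the edges from a new vertex to N: an
    instance of 2-satisfiability, where an edge of N forbids that both of its
    ends receive its own colour. *)
Definition satisfies (N : seq nat) (x : nat -> bool) : Prop :=
  forall y z, y \in N -> z \in N -> A y z -> ~ (x y = col y z /\ x z = col y z).

Lemma sub_satisfies N N' x :
  {subset N' <= N} -> satisfies N x -> satisfies N' x.
Proof. by move=> sub xP y z /sub yN /sub zN; apply: xP. Qed.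

(** The colours of the edges at a vertex with link N are a solution. *)
Lemma splittable_satisfies N : splittable s A N -> exists x, satisfies N x.
Proof.
move=> /(extension 0)[u [_ ltN uN]]; exists (col u) => y z yN zN Ayz [ey ez].
by apply: (@no_mono u y z); rewrite ?uN ?ltN ?ey ?ez.
Qed.

Lemma other_spoke c u x y : A u x -> A u y -> A x y -> col x y = c ->
  col u x = ~~ c \/ col u y = ~~ c.
Proof.
move=> Aux Auy Axy xyc; have := no_mono Aux Auy Axy; rewrite xyc.
by case: (col u x) (col u y) c {xyc} => [] [] [] no; auto; case: no.
Qed.

Lemma splittable_proper N (g : nat -> bool) :
  (forall y z, y \in N -> z \in N -> A y z -> g y <> g z) -> splittable s A N.
Proof. by move=> gP; exists (fun v _ => g v) => y z yN zN Ayz i j _ _ /(gP y z yN zN Ayz). Qed.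

Lemma splittable1 v : splittable s A [:: v].
Proof.
by apply: (@splittable_proper _ xpredT) => y z; rewrite !inE => /eqP-> /eqP->; rewrite Airr.
Qed.

Lemma splittable_pair x y : splittable s A [:: x; y].
Proof.
have [->|ne] := eqVneq x y.
  by apply: sub_splittable (splittable1 y) => v; rewrite !inE orbb.
apply: (@splittable_proper _ (pred1 x)) => u v; rewrite !inE /=.
by move=> /orP[]/eqP-> /orP[]/eqP->; rewrite ?Airr // eqxx eq_sym (negPf ne).
Qed.

(** Separation up to one edge: this still allows splittings of N and M to be
    combined. *)
Definition bridged (N M : seq nat) (a b : nat) : Prop :=
  forall v w, v \in N -> w \in M -> v <> w /\ (A v w -> v = a /\ w = b).

(** In each of the s colourings, swapping the two colours on M if necessary gives
    a and b different colours. *)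
Lemma splittable_cat N M a b : splittable s A N -> splittable s A M ->
  bridged N M a b -> splittable s A (N ++ M).
Proof.
move=> [f fP] [g gP] br.
exists (fun v i => if v \in N then f v i else g v i (+) ~~ (f a i (+) g b i)) => y z.
have notM v : v \in N -> v \notin M by move=> vN; apply/negP => /(br _ _ vN)[].
have notN w : w \in M -> w \in N = false by move=> wM; apply/negP => /notM; rewrite wM.
rewrite !mem_cat => /orP[yN|yM] /orP[zN|zM] Ayz i j lti ltj.
- by rewrite yN zN; apply: fP.
- have [_ /(_ Ayz) [-> ->]] := br _ _ yN zM.
  case: ifP => [aN|]; last first.
    have [_ /(_ Ayz) [<- _]] := br _ _ yN zM; by rewrite yN.
  have [_ /(_ Ayz) [_ <-]] := br _ _ yN zM.
  by rewrite (notN _ zM); case: (f a i); case: (g z i).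
- rewrite Asym in Ayz; have [_ /(_ Ayz) [ez ey]] := br _ _ zN yM.
  rewrite zN -ez -ey (notN _ yM); by case: (f z i); case: (g y i).
- rewrite !notN // => /addIb ei /addIb ej; exact: (gP y z).
Qed.

(** Every vertex that is joined to all of N is joined to u in colour c. *)
Definition forces (c : bool) (u : nat) (N : seq nat) : Prop :=
  [/\ u \in N, splittable s A N & forall x, satisfies N x -> x u = c].

Lemma bridged1 w N u : w \notin N -> (forall v, v \in N -> A w v -> v = u) ->
  bridged [:: w] N w u.
Proof.
move=> wN wu v v'; rewrite inE => /eqP-> v'N; split=> [e|Awv]; last by rewrite (wu v').
by rewrite e v'N in wN.
Qed.

Lemma forces_step c u N w : forces c u N -> w \notin N -> A w u -> col w u = c ->
  (forall v, v \in N -> A w v -> v = u) -> forces (~~ c) w (w :: N).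
Proof.
move=> [uN spN xN] wN Awu wuc wu; split; first exact: mem_head.
  rewrite -cat1s; apply: (splittable_cat (splittable1 w) spN) (bridged1 wN wu).
move=> x xP; have xu : x u = c.
  by apply/xN/sub_satisfies/xP => v vN; rewrite inE vN orbT.
have := xP w u (mem_head _ _); rewrite inE uN orbT wuc xu => /(_ isT Awu).
by case: (x w) c {wuc xu xN} => [] [] no //; case: no.
Qed.

(** The two gadgets together are splittable, so some vertex is joined to all of
    them; with u and w it spans a monochromatic triangle. *)
Lemma forces_clash c u N w M : forces c u N -> forces c w M -> A u w ->
  col u w = c -> bridged N M u w -> False.
Proof.
move=> [uN spN xN] [wM spM xM] Auw uwc br.
have [x xP] := splittable_satisfies (splittable_cat spN spM br).
apply: (xP u w) => //; rewrite ?mem_cat ?uN ?wM ?orbT // uwc; split.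
  by apply/xN/sub_satisfies/xP => v; rewrite mem_cat => ->.
by apply/xM/sub_satisfies/xP => v; rewrite mem_cat orbC => ->.
Qed.

Definition bound (N : seq nat) := (\max_(v <- N) v).+1.

Lemma ltn_bound N v : v \in N -> v < bound N.
Proof. by move=> vN; rewrite ltnS (big_rem v) //= leq_maxl. Qed.

(** Such sets are disjoint from everything below L and not joined to it, so
    gadgets above successive bounds never interfere. *)
Definition above (L : nat) (N : seq nat) : Prop :=
  forall v, v \in N -> L <= v /\ forall w, w < L -> ~~ A v w.

(** The variant of above for a gadget whose root u has been joined on purpose to a
    set Z of older vertices. *)
Definition attached (B : nat) (Z : seq nat) (u : nat) (N : seq nat) : Prop :=
  forall v, v \in N -> B <= v /\ forall w, w < B -> A v w -> v = u /\ w \in Z.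

Lemma above_leq L L' N : L' <= L -> above L N -> above L' N.
Proof.
move=> le ab v /ab[Lv noL]; split=> [|w lt]; first exact: leq_trans Lv.
exact/noL/(leq_trans lt).
Qed.

Lemma sub_above L N N' : {subset N' <= N} -> above L N -> above L N'.
Proof. by move=> sub ab v /sub /ab. Qed.

Lemma above_cat L N M : above L N -> above L M -> above L (N ++ M).
Proof. by move=> aN aM v; rewrite mem_cat => /orP[/aN|/aM]. Qed.

Lemma attached_above L B Z u N : L <= B -> (forall z, z \in Z -> L <= z) ->
  attached B Z u N -> above L N.
Proof.
move=> LB LZ att v /att[Bv vB]; split=> [|w lt]; first exact: leq_trans Bv.
apply/negP => /(vB w (leq_trans lt LB))[_ /LZ]; by rewrite leqNgt lt.
Qed.

Lemma above_bridged L N M a b : (forall v, v \in N -> v < L) -> above L M ->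
  bridged N M a b.
Proof.
move=> NL aM v w /NL lt /aM[Lw noL]; split=> [e|Avw].
  by move: Lw; rewrite -e leqNgt lt.
by case/negP: (noL v lt); rewrite Asym.
Qed.

(** * Alternating paths and odd cycles *)

(** The first colour of an alternating path with k edges whose last edge has
    colour ~~ r. *)
Definition phase (r : bool) (k : nat) := r (+) odd k.

(** Models an induced alternating path N with k edges from a root u to a leaf q, whose
    last edge at q has colour ~~ r, as seen by a new vertex: the implication along
    the path is recorded in path_imp, and the height function is what remains of
    the shape of the path.  The root may be joined to prescribed older vertices Z.
    The set M stays outside the path and carries side information about the leaf,
    such as a gadget forcing the colour at a neighbour of q. *)
Record alt_path (r : bool) (k B : nat) (Z : seq nat) (u q : nat) (N M : seq nat) : Prop :=
  AltPath {
  root_in : u \in N;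
  leaf_in : q \in N;
  path_attached : attached B Z u (N ++ M);
  root_adj : forall w, w \in Z -> A u w;
  height : exists h : nat -> nat, [/\ h u = k, h q = 0 & forall y z, y \in N -> z \in N ->
             A y z -> h y = (h z).+1 \/ h z = (h y).+1];
  path_imp : forall x, satisfies N x -> x u = phase r k -> x q = r;
  path_disj : forall v, v \in N -> v \notin M }.

(** The hypothesis carried along an induction on k.  Prescribing the set Z of older
    neighbours of the root is what allows the roots of different paths to be joined;
    Q is a quality that leaves have from the start. *)
Definition supply (Q : nat -> seq nat -> Prop) (L : nat) (r : bool) (k : nat) : Prop :=
  forall B Z, L <= B -> (forall z, z \in Z -> L <= z < B) -> splittable s A Z ->
  exists u q N M, alt_path r k B Z u q N M /\ Q q M.

Lemma alt_path_weaken r k B B' Z u q N M : B <= B' -> (forall z, z \in Z -> B <= z) ->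
  alt_path r k B' Z u q N M -> alt_path r k B [::] u q N M.
Proof.
move=> le BZ [uN qN att adjZ hP imp disj]; split=> // v /att[Bv vB].
split=> [|w lt Avw]; first exact: leq_trans Bv.
by have [_ /BZ] := vB w (leq_trans lt le) Avw; rewrite leqNgt lt.
Qed.

Lemma alt_path_extend r k B Z u x p N M : alt_path r k B [::] x p N M ->
  B <= u -> (forall v, v \in N ++ M -> v < u) -> A u x -> col u x = ~~ phase r k ->
  (forall v, v \in N ++ M -> A u v -> v = x) -> (forall w, w < B -> A u w = (w \in Z)) ->
  (forall z, z \in Z -> z < B) -> alt_path r k.+1 B Z u p (u :: N) M.
Proof.
move=> [xN pN att _ [h [hx hp hP]] imp disj] Bu ltu Aux uxc ux uB ZB.
have ltN v : v \in N -> v < u by move=> vN; apply: ltu; rewrite mem_cat vN.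
have uxN v : v \in N -> A u v -> v = x by move=> vN; apply: ux; rewrite mem_cat vN.
split.
- exact: mem_head.
- by rewrite inE pN orbT.
- move=> v; rewrite cat_cons inE => /predU1P[->|/att[Bv vB]]; split=> // w lt.
    by rewrite uB.
  by move=> /(vB w lt) [].
- by move=> w wZ; rewrite uB ?ZB.
- exists (fun v => if v == u then k.+1 else h v).
  have neu v : v \in N -> (v == u) = false by move=> /ltN lt; rewrite ltn_eqF.
  rewrite eqxx neu //; split=> // y z; rewrite !inE => /predU1P[->|yN] /predU1P[->|zN].
  + by rewrite Airr.
  + by rewrite eqxx neu // => /(uxN z zN) ->; rewrite hx; left.
  + by rewrite eqxx neu // Asym => /(uxN y yN) ->; rewrite hx; right.
  + by rewrite !neu //; apply: hP.
- move=> y yP yu; have yPN : satisfies N y by apply: sub_satisfies yP => v vN; rewrite inE vN orbT.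
  apply: imp => //; have := yP u x (mem_head _ _); rewrite inE xN orbT uxc => /(_ isT Aux).
  rewrite yu /phase /= addbN; case: (y x) (r (+) odd k) => [] [] no //; by case: no.
- move=> v; rewrite inE => /predU1P[->|/disj//].
  by apply/negP => uM; have := ltu u; rewrite mem_cat uM orbT ltnn => /(_ isT).
Qed.

Lemma bridged_sym N M a b : bridged N M a b -> bridged M N b a.
Proof.
move=> br v w vM wN; have [ne e] := br w v wN vM; split=> [?|]; first exact: ne.
by rewrite Asym => /e[].
Qed.

Lemma attached_bridged B Z u N x W : attached B Z u N -> (forall v, v \in W -> v < B) ->
  (forall v, v \in W -> v \in Z -> v = x) -> bridged W N x u.
Proof.
move=> att WB WZ v w vW /att[Bw wB]; split=> [e|].
  by have := WB v vW; rewrite ltnNge e Bw.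
by rewrite Asym => /(wB v (WB v vW)) [-> /(WZ v vW)].
Qed.

(** Take paths with roots x0 and x1 such that x0x1 is an edge.  If it has the wrong
    colour, take a third path whose root is joined to both x0 and x1: one of the two
    new edges has the right colour, since there is no monochromatic triangle. *)
Lemma supply_pair Q L r k B : supply Q L r k -> L <= B ->
  exists x p N M y p' N' M',
    [/\ alt_path r k B [::] x p N M, alt_path r k B [::] y p' N' M', Q p M & Q p' M'] /\
    [/\ A x y, col x y = phase r k & bridged (N ++ M) (N' ++ M') x y].
Proof.
move=> sup LB.
have [|x0 [p0 [N0 [M0 [P0 Q0]]]]] := sup B [::] LB _ (splittable_nil s A); first by [].
have x0N : x0 \in N0 ++ M0 by rewrite mem_cat (root_in P0).
have Bx0 : B <= x0 by have [] := path_attached P0 x0N.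
pose B1 := maxn B (bound (N0 ++ M0)).
have le1 : B <= B1 by exact: leq_maxl.
have W0 v : v \in N0 ++ M0 -> v < B1.
  by move=> /ltn_bound lt; apply: leq_trans lt _; exact: leq_maxr.
have Z1 z : z \in [:: x0] -> L <= z < B1.
  by rewrite inE => /eqP->; rewrite (leq_trans LB Bx0) W0.
have [x1 [p1 [N1 [M1 [P1 Q1]]]]] := sup B1 [:: x0] (leq_trans LB le1) Z1 (splittable1 x0).
have A01 : A x0 x1 by rewrite Asym (root_adj P1) ?mem_head.
have P1' : alt_path r k B [::] x1 p1 N1 M1.
  by apply: alt_path_weaken P1 => // z; rewrite inE => /eqP->.
have [c01|c01] := eqVneq (col x0 x1) (phase r k).
  exists x0, p0, N0, M0, x1, p1, N1, M1; do 2!split=> //.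
  by apply: attached_bridged (path_attached P1) W0 _ => v _; rewrite inE => /eqP.
have x1N : x1 \in N1 ++ M1 by rewrite mem_cat (root_in P1).
have Bx1 : B1 <= x1 by have [] := path_attached P1 x1N.
pose B2 := maxn B1 (bound (N1 ++ M1)).
have le2 : B1 <= B2 by exact: leq_maxl.
have W1 v : v \in N1 ++ M1 -> v < B2.
  by move=> /ltn_bound lt; apply: leq_trans lt _; exact: leq_maxr.
have Z2 z : z \in [:: x0; x1] -> L <= z < B2.
  rewrite !inE => /orP[]/eqP->; last by rewrite W1 // (leq_trans (leq_trans LB le1)).
  by rewrite (leq_trans LB Bx0) (leq_trans (W0 _ x0N) le2).
have [x2 [p2 [N2 [M2 [P2 Q2]]]]] := sup B2 _ (leq_trans (leq_trans LB le1) le2) Z2 (splittable_pair x0 x1).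
have [A20 A21] : A x2 x0 /\ A x2 x1 by rewrite !(root_adj P2) ?inE ?eqxx ?orbT.
have P2' : alt_path r k B [::] x2 p2 N2 M2.
  apply: alt_path_weaken P2 => [|z]; first exact: leq_trans le2.
  by rewrite !inE => /orP[]/eqP-> //; apply: leq_trans Bx1.
have c01' : col x0 x1 = ~~ phase r k by case: (col _ _) (phase _ _) c01 => [] [].
have [] := other_spoke A20 A21 A01 c01'; rewrite negbK col_sym => c2.
  exists x0, p0, N0, M0, x2, p2, N2, M2; do 2!split=> //; first by rewrite Asym.
  apply: attached_bridged (path_attached P2) _ _ => v vW.
    exact: leq_trans (W0 v vW) le2.
  rewrite !inE => /orP[]/eqP // e.
  by have := leq_trans (W0 v vW) Bx1; rewrite e ltnn.
exists x1, p1, N1, M1, x2, p2, N2, M2; do 2!split=> //; first by rewrite Asym.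
apply: attached_bridged (path_attached P2) W1 _ => v vW.
rewrite !inE => /orP[]/eqP // e.
have [B1v _] := path_attached P1 vW.
by have := leq_trans (W0 _ x0N) B1v; rewrite e ltnn.
Qed.

Lemma splittable_cat_above N Z L : above L N -> (forall z, z \in Z -> z < L) ->
  splittable s A N -> splittable s A Z -> splittable s A (N ++ Z).
Proof.
move=> aN ZL spN spZ; (* No edge joins N and Z, so the ends of the bridge are arbitrary. *)
apply: (@splittable_cat _ _ 0 0 spN spZ).
exact/bridged_sym/above_bridged/aN.
Qed.

Lemma fresh_vertex N Z L B : above L N -> (forall z, z \in Z -> z < L) ->
  splittable s A N -> splittable s A Z ->
  exists u, [/\ L <= u, B <= u, forall v, v \in N -> v < u,
    forall v, v < u -> A u v = (v \in N) || (v \in Z) & forall v, v < L -> A u v = (v \in Z)].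
Proof.
move=> aN ZL spN spZ.
have [u [Bu ltu uE]] := extension (maxn L B) (splittable_cat_above aN ZL spN spZ).
move: Bu; rewrite geq_max => /andP[Lu Bu].
exists u; split=> // [v vN|v lt|v lt].
- by apply: ltu; rewrite mem_cat vN.
- by rewrite uE // mem_cat.
- rewrite uE ?(leq_trans lt) // mem_cat; case: (boolP (v \in N)) => // /aN[].
  by rewrite leqNgt lt.
Qed.

Lemma above_nil_attached B u N : attached B [::] u N -> above B N.
Proof. by move/attached_above; apply. Qed.

(** A new vertex joined to the two roots of such a pair is joined to one of them in
    the other colour, which prolongs the alternating path from that root. *)
Lemma supply_step Q L r k : supply Q L r k -> supply Q L r k.+1.
Proof.
move=> sup B Z LB LZ spZ.
have [x [p [N [M [y [p' [N' [M' [[P P' Qp Qp'] [Axy xyc br]]]]]]]]]] := supply_pair sup LB.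
have ZB z : z \in Z -> z < B by move=> /LZ/andP[].
have aW := above_nil_attached (path_attached P).
have aW' := above_nil_attached (path_attached P').
have xW : x \in N ++ M by rewrite mem_cat (root_in P).
have yW : y \in N' ++ M' by rewrite mem_cat (root_in P').
have axy : above B [:: x; y].
  by move=> v; rewrite !inE => /orP[]/eqP->; [apply: aW|apply: aW'].
have [u [Bu ltu uxy uE uB]] :=
  fresh_vertex (bound ((N ++ M) ++ (N' ++ M'))) axy ZB (splittable_pair x y) spZ.
have ltW v : v \in N ++ M -> v < u.
  by move=> vW; apply: leq_trans ltu; apply: ltn_bound; rewrite mem_cat vW.
have ltW' v : v \in N' ++ M' -> v < u.
  by move=> vW; apply: leq_trans ltu; apply: ltn_bound; rewrite mem_cat vW orbT.
have Aux : A u x by rewrite uE ?ltW // mem_head.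
have Auy : A u y by rewrite uE ?ltW' // !inE eqxx orbT.
have notZ v : B <= v -> v \in Z = false.
  by move=> le; apply/negP => /ZB; rewrite ltnNge le.
have [uc|uc] := other_spoke Aux Auy Axy xyc.
  exists u, p, (u :: N), M; split=> //; apply: (alt_path_extend P) => // v vW.
  rewrite uE ?ltW // (notZ v) ?orbF; last by have [] := aW v vW.
  by rewrite !inE => /orP[]/eqP // e; have [] := br v y vW yW; rewrite e.
exists u, p', (u :: N'), M'; split=> //; apply: (alt_path_extend P') => // v vW.
rewrite uE ?ltW' // (notZ v) ?orbF; last by have [] := aW' v vW.
by rewrite !inE => /orP[]/eqP // e; have [] := br x v xW vW; rewrite e.
Qed.

(** A vertex v joined to both ends of an alternating path of odd length k, both of
    whose end edges have colour ~~ r, and joined in colour r to the root, closes an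
    odd cycle with exactly one vertex between two edges of the same colour: v or
    the leaf p.  Suppose a new vertex, joined to the whole cycle, gave that vertex
    the colour of its two cycle edges; then its other colours would be determined
    one after the other, and clash on returning.  The cycle is splittable because
    it is long. *)
Lemma close_path r k B x p N M v : alt_path r k B [::] x p N M ->
  odd k -> s <= k -> v \notin N -> A v x -> A v p ->
  (forall w, w \in N -> A v w -> w = x \/ w = p) -> col v x = r ->
  (col v p = r -> forces (~~ r) v (v :: N)) /\ (col v p = ~~ r -> forces r p (v :: N)).
Proof.
move=> [xN pN _ _ [h [hx hp hP]] imp _] kodd sk vN Avx Avp vxp cx.
have nev w : w \in N -> (w == v) = false by move=> wN; apply/eqP => e; rewrite -e wN in vN.
(* The i-th colouring has its defect between heights i and i.+1. *)
have spl : splittable s A (v :: N).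
  exists (fun w i => if w == v then true else odd (h w) (+) (i < h w)).
  have fv w i : w \in N -> A v w -> i < s -> odd (h w) (+) (i < h w) = false.
    move=> wN /(vxp w wN)[]-> lti; last by rewrite hp.
    by rewrite hx kodd (leq_trans lti sk).
  have fN a b i : h a = (h b).+1 ->
      odd (h a) (+) (i < h a) = odd (h b) (+) (i < h b) -> i = h b.
    by move=> ->; rewrite /= ltnS; case: (ltngtP i (h b)); case: (odd _).
  move=> y z; rewrite !inE => /predU1P[->|yN] /predU1P[->|zN].
  - by rewrite Airr.
  - by rewrite eqxx nev // => Avz i j lti ltj; rewrite fv.
  - by rewrite eqxx nev // Asym => Avy i j lti ltj; rewrite fv.
  - rewrite !nev // => /(hP y z yN zN)[] e i j _ _; first by move=> /(fN _ _ _ e)-> /(fN _ _ _ e)->.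
    by move=> /esym/(fN _ _ _ e)-> /esym/(fN _ _ _ e)->.
have inN w : w \in N -> w \in v :: N by move=> wN; rewrite inE wN orbT.
have vin : v \in v :: N := mem_head _ _.
have chain y : satisfies (v :: N) y -> y v = r -> y p = r.
  move=> yP yv; apply: imp; first by apply: sub_satisfies yP.
  have := yP v x vin (inN _ xN) Avx; rewrite /phase kodd addbT cx yv.
  by case: (y x) r {yv cx} => [] [] no //; case: no.
split=> cp; split=> //; first 1 last.
- exact: inN.
- move=> y yP; have := yP v p vin (inN _ pN) Avp; rewrite cp; have := chain y yP.
  by case: (y v) (y p) r {imp chain cx cp} => [] [] [] // ch no; try (by rewrite ch); case: no.
move=> y yP; have := yP v p vin (inN _ pN) Avp; rewrite cp; have := chain y yP.
by case: (y v) (y p) r {imp chain cx cp} => [] [] [] // ch no; try (by have := ch erefl); case: no.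
Qed.

(** The closing vertex v is joined to both roots of a pair from supply_pair, and so
    in colour r to one of them, and to both leaves.  Either the new vertex v or an
    old leaf q of quality Q gets a forced colour. *)
Lemma close_cycle Q L r k B Z : supply Q L r k -> L <= B ->
  (forall z, z \in Z -> L <= z < B) -> splittable s A Z -> odd k -> s <= k -> 1 < k ->
  (exists v N, [/\ forces (~~ r) v N, attached B Z v N & forall z, z \in Z -> A v z]) \/
  (exists q N M, [/\ forces r q N, Q q M, above L N & forall v, v \in N -> v \notin M]).
Proof.
move=> sup LB LZ spZ kodd sk k1.
have [x [p [N [M [y [p' [N' [M' [[P P' Qp Qp'] [Axy xyc br]]]]]]]]]] := supply_pair sup LB.
have ZB z : z \in Z -> z < B by move=> /LZ/andP[].
have aW := above_nil_attached (path_attached P).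
have aW' := above_nil_attached (path_attached P').
have NW v : v \in N -> v \in N ++ M by rewrite mem_cat => ->.
have NW' v : v \in N' -> v \in N' ++ M' by rewrite mem_cat => ->.
have xN := root_in P; have pN := leaf_in P; have yN := root_in P'; have pN' := leaf_in P'.
have [far ne] : ~~ A x p /\ x != p.
  have [h [hx hp hP]] := height P; split.
    apply/negP => /(hP x p xN pN)[]; rewrite hx hp // => e; by rewrite e in k1.
  by apply/eqP => e; move: k1; rewrite -hx e hp.
have [far' ne'] : ~~ A y p' /\ y != p'.
  have [h [hx hp hP]] := height P'; split.
    apply/negP => /(hP y p' yN pN')[]; rewrite hx hp // => e; by rewrite e in k1.
  by apply/eqP => e; move: k1; rewrite -hx e hp.
pose S := [:: x; p] ++ [:: y; p'].
have sub v : v \in [:: x; p] -> v \in N ++ M.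
  by rewrite !inE => /orP[]/eqP->; apply: NW.
have sub' v : v \in [:: y; p'] -> v \in N' ++ M'.
  by rewrite !inE => /orP[]/eqP->; apply: NW'.
have aS : above B S by apply: above_cat; [apply: sub_above aW|apply: sub_above aW'].
have spS : splittable s A S.
  apply: (@splittable_cat _ _ x y); try exact: splittable_pair.
  by move=> v w /sub vN /sub' wN; apply: br.
have [v [Bv ltv vS vE vB]] :=
  fresh_vertex (bound ((N ++ M) ++ (N' ++ M'))) aS ZB spS spZ.
have ltW w : w \in N ++ M -> w < v.
  by move=> wW; apply: leq_trans ltv; apply: ltn_bound; rewrite mem_cat wW.
have ltW' w : w \in N' ++ M' -> w < v.
  by move=> wW; apply: leq_trans ltv; apply: ltn_bound; rewrite mem_cat wW orbT.
have notZ w : B <= w -> w \in Z = false.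
  by move=> le; apply/negP => /ZB; rewrite ltnNge le.
have AS w : w \in S -> A v w by move=> wS; rewrite vE ?vS ?wS.
have [Avx Avp] : A v x /\ A v p by rewrite !AS // /S !inE ?eqxx ?orbT.
have [Avy Avp'] : A v y /\ A v p' by rewrite !AS // /S !inE ?eqxx ?orbT.
have finish u q N0 M0 : alt_path r k B [::] u q N0 M0 -> Q q M0 -> A v u -> A v q ->
    (forall w, w \in N0 ++ M0 -> w < v) -> (forall w, w \in N0 -> A v w -> w = u \/ w = q) ->
    col v u = r ->
  (exists v N, [/\ forces (~~ r) v N, attached B Z v N & forall z, z \in Z -> A v z]) \/
  (exists q N M, [/\ forces r q N, Q q M, above L N & forall v, v \in N -> v \notin M]).
  move=> P0 Q0 Avu Avq lt0 only cu.
  have vN0 : v \notin N0.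
    by apply/negP => vin; have := lt0 v; rewrite mem_cat vin ltnn => /(_ isT).
  have [f1 f2] := close_path P0 kodd sk vN0 Avu Avq only cu.
  have att : attached B Z v (v :: N0).
    move=> w; rewrite inE => /predU1P[->|wN0].
      by split=> // z lt; rewrite vB.
    have [Bw wB] : B <= w /\ forall z, z < B -> ~~ A w z.
      by apply: (above_nil_attached (path_attached P0)); rewrite mem_cat wN0.
    by split=> // z lt Awz; case/negP: (wB z lt).
  have [c|c] := eqVneq (col v q) r.
    by left; exists v, (v :: N0); split=> // [|z zZ]; [exact: f1|rewrite vB ?ZB].
  right; exists q, (v :: N0), M0; split=> //.
  - by apply: f2; case: (col v q) r c {P P' P0 sup xyc cu f1} => [] [].
  - by apply: attached_above att => // z /LZ/andP[].
  - move=> w; rewrite inE => /predU1P[->|/(path_disj P0)//].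
    by apply/negP => vM; have := lt0 v; rewrite mem_cat vM orbT ltnn => /(_ isT).
have phE : ~~ phase r k = r by rewrite /phase kodd addbT negbK.
have [|] := other_spoke Avx Avy Axy xyc; rewrite phE => c.
  apply: (finish x p N M) => // w wN; rewrite vE ?ltW ?NW // notZ ?orbF; last first.
    by have [] := aW w (NW w wN).
  rewrite /S !inE => /or4P[]/eqP; auto => e.
    by have [/(_ e)] := br w y (NW _ wN) (NW' _ yN).
  by have [/(_ e)] := br w p' (NW _ wN) (NW' _ pN').
apply: (finish y p' N' M') => // w wN; rewrite vE ?ltW' ?NW' // notZ ?orbF; last first.
  by have [] := aW' w (NW' w wN).
rewrite /S !inE => /or4P[]/eqP; auto => e.
  by have [/(_ (esym e))] := br x w (NW _ xN) (NW' _ wN).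
by have [/(_ (esym e))] := br p w (NW _ pN) (NW' _ wN).
Qed.

Lemma alt_path0 r B Z u M : B <= u -> (forall w, w < B -> A u w = (w \in Z)) ->
  (forall z, z \in Z -> z < B) -> above B M -> u \notin M -> alt_path r 0 B Z u u [:: u] M.
Proof.
move=> Bu uB ZB aM uM; split; rewrite ?mem_head //.
- move=> v; rewrite inE => /predU1P[->|/aM[Bv vB]]; split=> // w lt.
    by rewrite uB.
  by move=> Avw; case/negP: (vB w lt).
- by move=> w wZ; rewrite uB ?ZB.
- exists (fun _ => 0); split=> // y z; rewrite !inE => /eqP-> /eqP->; by rewrite Airr.
- by move=> x _; rewrite /phase addbF.
- by move=> v; rewrite inE => /eqP->.
Qed.

Lemma supply_long Q L r : supply Q L r 0 ->
  exists2 k, supply Q L r k & [/\ odd k, s <= k & 1 < k].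
Proof.
move=> sup; exists (s.+1).*2.+1; last first.
  split; rewrite /= ?odd_double //.
  by apply: leq_trans (leqnSn s) _; apply: leqW; rewrite -addnn leq_addr.
elim: (_.+1) => // k IHk; exact: supply_step.
Qed.

(** * Forcing both colours, and the contradiction *)

(** Closing a cycle over leaves of no particular quality forces some colour, but
    which one cannot be controlled yet. *)
Lemma some_forcer L : exists c u N, forces c u N /\ above L N.
Proof.
have sup : supply (fun _ _ => True) L true 0.
  move=> B Z LB LZ spZ; have ZB z : z \in Z -> z < B by move=> /LZ/andP[].
  have [|u [Bu _ _ _ uB]] := fresh_vertex 0 (_ : above B [::]) ZB (splittable_nil s A) spZ.
    by [].
  by exists u, u, [:: u], [::]; split=> //; apply: alt_path0.
have [k supk [kodd sk k1]] := supply_long sup.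
have [||[v [N [fN att _]]]|[q [N [M [fN _ aN _]]]]] :=
  close_cycle (Z := [::]) supk (leqnn L) _ _ kodd sk k1.
- by [].
- exact: splittable_nil.
- by exists false, v, N; split=> //; apply: above_nil_attached att.
- by exists true, q, N.
Qed.

(** A vertex joined to both u and w is joined to one of them in colour c, and thus
    gets the forced colour ~~ c itself.  So one tension produces vertices of the
    opposite forced colour at will. *)
Definition tension c L u N w M : Prop :=
  [/\ forces c u N, forces c w M, A u w & col u w = ~~ c] /\
  [/\ w \notin N, u \notin M & above L (N ++ M)].

Lemma tension_apex c L u N w M v : tension c L u N w M -> A v u -> A v w ->
  (forall t, t \in N ++ M -> A v t -> t = u \/ t = w) ->
  exists t T, [/\ {subset T <= N ++ M}, forces c t T, A v t, col v t = c
                & forall z, z \in T -> A v z -> z = t].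
Proof.
move=> [[fu fw Auw uwc] [wN uM _]] Avu Avw vuw.
have [cv|cv] := other_spoke Avu Avw Auw uwc; rewrite negbK in cv.
  exists u, N; split=> // [z zN|z zN Avz]; first by rewrite mem_cat zN.
  have zNM : z \in N ++ M by rewrite mem_cat zN.
  by have [//|e] := vuw z zNM Avz; rewrite -e zN in wN.
exists w, M; split=> // [z zM|z zM Avz]; first by rewrite mem_cat zM orbT.
have zNM : z \in N ++ M by rewrite mem_cat zM orbT.
by have [e|//] := vuw z zNM Avz; rewrite -e zM in uM.
Qed.

(** If no vertex beyond L had forced colour c, all forced vertices beyond L would
    have colour r = ~~ c.  Let every leaf of the alternating paths be joined to such
    a forced vertex a.  In colour r this would force c at the leaf, so the edge has
    colour c.  Closing a cycle then forces r at a leaf q, and q and a form a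
    tension, from which a vertex of forced colour c arises after all. *)
Lemma forcer c L : exists u N, forces c u N /\ above L N.
Proof.
apply: contrapT => none; pose r := ~~ c.
have noc u N : forces (~~ r) u N -> above L N -> False.
  by rewrite negbK => fN aN; apply: none; exists u, N.
have anyr B : L <= B -> exists a M, forces r a M /\ above B M.
  move=> LB; have [c' [a [M [fM aM]]]] := some_forcer B; exists a, M.
  have [<-//|ne] := eqVneq c' r; case: (@noc a M); last exact: above_leq aM.
  by case: c' r ne fM {noc aM} => [] [].
pose Q q M := exists a, [/\ forces r a M, A q a, col q a = ~~ r & above L M].
have sup : supply Q L r 0.
  move=> B Z LB LZ spZ; have ZB z : z \in Z -> z < B by move=> /LZ/andP[].
  have [a [M [fM aM]]] := anyr B LB; have [aM' _ _] := fM.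
  have aa : above B [:: a] by move=> v; rewrite inE => /eqP->; apply: aM.
  have [u [Bu ltu au uE uB]] := fresh_vertex (bound M) aa ZB (splittable1 a) spZ.
  have ltM w : w \in M -> w < u by move=> wM; apply: leq_trans ltu; apply: ltn_bound.
  have uM : u \notin M by apply/negP => /ltM; rewrite ltnn.
  have Aua : A u a by rewrite uE ?ltM // mem_head.
  have uaM v : v \in M -> A u v -> v = a.
    move=> vM; rewrite uE ?ltM // inE => /orP[/eqP//|/ZB].
    by have [Bv _] := aM v vM; rewrite ltnNge Bv.
  have [ca|ca] := eqVneq (col u a) r.
    case: (noc u (u :: M) (forces_step fM uM Aua ca uaM)).
    move=> v; rewrite inE => /predU1P[->|/(above_leq LB aM)//].
    split=> [|w lt]; first exact: leq_trans Bu.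
    rewrite uB ?(leq_trans lt) //; apply/negP => /LZ; by rewrite leqNgt lt.
  exists u, u, [:: u], M; split; first exact: alt_path0.
  exists a; split=> //; last exact: above_leq aM.
  by case: (col u a) r ca {anyr noc Q fM} => [] [].
have [k supk [kodd sk k1]] := supply_long sup.
have [||[v [N [fN att _]]]|[q [N [M [fN [a [fM Aqa qac aM]] aN NM]]]]] :=
  close_cycle (Z := [::]) supk (leqnn L) _ _ kodd sk k1.
- by [].
- exact: splittable_nil.
- by apply: noc fN _; apply: above_nil_attached att.
have [aM' _ _] := fM; have [qN _ _] := fN.
have aqa : above L [:: q; a] by move=> v; rewrite !inE => /orP[]/eqP->; [apply: aN|apply: aM].
have [//|u [Lu ltu _ uE uB]] :=
  fresh_vertex (bound (N ++ M)) aqa (_ : forall z, z \in [::] -> z < L)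
    (splittable_pair q a) (splittable_nil s A).
have ltN w : w \in N ++ M -> w < u by move=> wN; apply: leq_trans ltu; apply: ltn_bound.
have ten : tension r L q N a M.
  do 2!split=> //; last exact: above_cat.
  - by apply/negP => /NM; rewrite aM'.
  - exact: NM.
have [||z zN|t [T [TN fT Aut cut only]]] := tension_apex ten (v := u).
- by rewrite uE ?ltN ?mem_cat ?qN // mem_head.
- by rewrite uE ?ltN ?mem_cat ?aM' ?orbT // !inE eqxx orbT.
- by rewrite uE ?ltN // orbF !inE => /orP[]/eqP; auto.
have uT : u \notin T by apply/negP => /TN/ltN; rewrite ltnn.
apply: noc (forces_step fT uT Aut cut only) _ => v; rewrite inE => /predU1P[->|/TN].
  by split=> // w lt; rewrite uB.
by apply: above_cat.
Qed.

(** Now each leaf u is joined to a vertex a forced to be true and to a vertex e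
    forced to be false.  The colours of ua and ue either give a contradiction or a
    tension, or are ua = false and ue = true.  In the last case close cycles with
    the closing vertex joined to a further vertex e' forced to be false: if the
    closing vertex gets forced, it is in tension with e'; if a leaf gets forced, it
    is in tension with its a. *)
Lemma tension_exists L : exists c u N w M, tension c L u N w M.
Proof.
apply: contrapT => none.
have no c u N w M : tension c L u N w M -> False.
  by move=> ten; apply: none; exists c, u, N, w, M.
have [e' [Ne' [fe' ae']]] := forcer false L; have [e'N _ _] := fe'.
pose B0 := maxn L (bound Ne'); have LB0 : L <= B0 := leq_maxl _ _.
pose Q q M := exists a, [/\ forces true a M, A q a, col q a = false & above L M].
have sup : supply Q L true 0.
  move=> B Z LB LZ spZ; have ZB z : z \in Z -> z < B by move=> /LZ/andP[].
  have [a [M [fM aM]]] := forcer true B; have [aM' _ _] := fM.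
  pose B1 := maxn B (bound M); have le1 : B <= B1 := leq_maxl _ _.
  have MB1 v : v \in M -> v < B1.
    by move=> /ltn_bound lt; apply: leq_trans lt (leq_maxr _ _).
  have [e [K [fK aK1]]] := forcer false B1; have [eK _ _] := fK.
  have aK := above_leq le1 aK1.
  have aae : above B [:: a; e].
    by move=> v; rewrite !inE => /orP[]/eqP->; [apply: aM|apply: aK].
  have [u [Bu ltu _ uE uB]] := fresh_vertex (bound (M ++ K)) aae ZB (splittable_pair a e) spZ.
  have ltMK w : w \in M ++ K -> w < u by move=> wM; apply: leq_trans ltu; apply: ltn_bound.
  have ltM w : w \in M -> w < u by move=> wM; apply: ltMK; rewrite mem_cat wM.
  have ltK w : w \in K -> w < u by move=> wM; apply: ltMK; rewrite mem_cat wM orbT.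
  have uM : u \notin M by apply/negP => /ltM; rewrite ltnn.
  have uK : u \notin K by apply/negP => /ltK; rewrite ltnn.
  have Aua : A u a by rewrite uE ?ltM // mem_head.
  have Aue : A u e by rewrite uE ?ltK // !inE eqxx orbT.
  have brMK := above_bridged a e MB1 aK1.
  have notZ w : B <= w -> w \in Z = false.
    by move=> le; apply/negP => /ZB; rewrite ltnNge le.
  have uaM v : v \in M -> A u v -> v = a.
    move=> vM; rewrite uE ?ltM // (notZ v) ?orbF; last by have [] := aM v vM.
    by rewrite !inE => /orP[]/eqP // ve; have [/(_ ve)] := brMK v e vM eK.
  have ueK v : v \in K -> A u v -> v = e.
    move=> vK; rewrite uE ?ltK // (notZ v) ?orbF; last by have [] := aK v vK.
    by rewrite !inE => /orP[]/eqP // va; have [/(_ (esym va))] := brMK a v aM' vK.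
  have auN T : above B T -> above L (u :: T).
    move=> aT v; rewrite inE => /predU1P[->|/(above_leq LB aT)//].
    split=> [|w lt]; first exact: leq_trans Bu.
    rewrite uB ?(leq_trans lt) //; apply/negP => /LZ; by rewrite leqNgt lt.
  have eM : e \notin u :: M.
    rewrite inE negb_or; apply/andP; split.
      by apply/eqP => eu; rewrite -eu eK in uK.
    by apply/negP => eM; have [] := brMK e e eM eK.
  have aK' : a \notin u :: K.
    rewrite inE negb_or; apply/andP; split.
      by apply/eqP => au; rewrite -au aM' in uM.
    by apply/negP => aK'; have [] := brMK a a aM' aK'.
  case cua: (col u a); case cue: (col u e).
  - case: (@no false u (u :: M) e K); do 2!split=> //.
      exact: forces_step fM uM Aua cua uaM.
    by apply: above_cat; [exact: auN|exact: above_leq aK].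
  - case: (forces_clash (forces_step fM uM Aua cua uaM) fK Aue cue).
    move=> v w; rewrite inE => /predU1P[->|vM] wK; last exact: (above_bridged u e MB1 aK1).
    by split=> [uw|Auw]; [rewrite uw wK in uK|split=> //; apply: ueK].
  - exists u, u, [:: u], M; split; first exact: alt_path0.
    by exists a; split=> //; exact: above_leq aM.
  - case: (@no true u (u :: K) a M); do 2!split=> //.
      exact: forces_step fK uK Aue cue ueK.
    by apply: above_cat; [exact: auN|exact: above_leq aM].
have [k supk [kodd sk k1]] := supply_long sup.
have Ne'B v : v \in Ne' -> v < B0.
  by move=> /ltn_bound lt; apply: leq_trans lt (leq_maxr _ _).
have LZ z : z \in [:: e'] -> L <= z < B0.
  by rewrite inE => /eqP->; rewrite Ne'B // andbT; have [] := ae' _ e'N.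
have [|[v [N [fN att vZ]]]|[q [N [M [fN [a [fM Aqa qac aM]] aN NM]]]]] :=
  close_cycle supk LB0 LZ _ kodd sk k1.
- exact: splittable1.
- have Ave' := vZ e' (mem_head _ _); have [vN _ _] := fN.
  have br : bridged Ne' N e' v.
    by apply: attached_bridged att Ne'B _ => w _; rewrite inE => /eqP.
  case cv: (col v e'); last first.
    by apply: forces_clash fe' fN _ _ br; rewrite 1?Asym // col_sym.
  apply: (@no false v N e' Ne'); do 2!split=> //.
  + by apply/negP => e'N'; have [] := br e' e' e'N e'N'.
  + by apply/negP => vN'; have [] := br v v vN' vN.
  + by apply: above_cat => //; apply: attached_above LB0 _ att => z /LZ/andP[].
have [aM' _ _] := fM.
have [qN _ _] := fN.
apply: (@no true q N a M); do 2!split=> //; last exact: above_cat.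
- by apply/negP => /NM; rewrite aM'.
- exact: NM.
Qed.

(** A vertex joined to all four ends gets the forced colour ~~ c from the first
    tension and is joined in this colour to an end of the second, which has the
    same forced colour. *)
Lemma opposite_tensions c L u N w M L' u' N' w' M' :
  tension c L u N w M -> tension (~~ c) L' u' N' w' M' ->
  (forall v, v \in N ++ M -> v < L') -> False.
Proof.
move=> ten ten' ltL'.
have [[[uN _ _] [wM _ _] _ _] _] := ten.
have [[[uN' _ _] [wM' _ _] _ _] [_ _ a']] := ten'.
have in1 v : v \in [:: u; w] -> v \in N ++ M.
  by rewrite !inE mem_cat => /orP[]/eqP->; rewrite ?uN ?wM ?orbT.
have in2 v : v \in [:: u'; w'] -> v \in N' ++ M'.
  by rewrite !inE mem_cat => /orP[]/eqP->; rewrite ?uN' ?wM' ?orbT.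
have ltZ z : z \in [:: u; w] -> z < L' by move/in1/ltL'.
have aZ : above L' [:: u'; w'] by apply: sub_above a'.
have [v [Lv ltv _ vE vL]] := fresh_vertex (bound ((N ++ M) ++ (N' ++ M'))) aZ ltZ
  (splittable_pair u' w') (splittable_pair u w).
have lt1 z : z \in N ++ M -> z < v.
  by move=> zN; apply: leq_trans ltv; apply: ltn_bound; rewrite mem_cat zN.
have lt2 z : z \in N' ++ M' -> z < v.
  by move=> zN; apply: leq_trans ltv; apply: ltn_bound; rewrite mem_cat zN orbT.
have not2 z : z \in N ++ M -> z \in [:: u'; w'] = false.
  by move=> /ltL' lt; apply/negP => /aZ[]; rewrite leqNgt lt.
have not1 z : z \in N' ++ M' -> z \in [:: u; w] = false.
  by move=> /a'[Lz _]; apply/negP => /ltZ; rewrite ltnNge Lz.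
have [||z zN|t [T [TN fT Avt cvt only]]] := tension_apex ten (v := v).
- by rewrite vE ?lt1 ?mem_head ?orbT // mem_cat uN.
- by rewrite vE ?lt1 ?mem_cat ?wM ?orbT // !inE eqxx !orbT.
- by rewrite vE ?lt1 // not2 // orFb !inE => /orP[]/eqP; auto.
have [||z zN|t' [T' [TN' fT' Avt' cvt' only']]] := tension_apex ten' (v := v).
- by rewrite vE ?lt2 ?mem_head ?orbT // mem_cat uN'.
- by rewrite vE ?lt2 ?mem_cat ?wM' ?orbT // !inE eqxx !orbT.
- by rewrite vE ?lt2 // not1 // orbF !inE => /orP[]/eqP; auto.
have vT : v \notin T by apply/negP => /TN/lt1; rewrite ltnn.
apply: forces_clash (forces_step fT vT Avt cvt only) fT' Avt' cvt' _.
move=> y z; rewrite inE => /predU1P[->|/TN/ltL' lt] zT'.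
  split=> [e|Avz]; first by have := lt2 z (TN' z zT'); rewrite -e ltnn.
  by split=> //; apply: only'.
have [Lz no] := a' z (TN' z zT'); split=> [e|Ayz]; first by move: Lz; rewrite -e leqNgt lt.
by case/negP: (no y lt); rewrite Asym.
Qed.

(** It remains to find tensions of both kinds.  If two tensions are of the same kind
    c, let x be joined to the first and y to the second and to x.  Both get the
    forced colour ~~ c, so they form a tension of the other kind. *)
Lemma no_avoiding_colouring : False.
Proof.
have [c [u [N [w [M ten]]]]] := tension_exists 0.
have [[[uN _ _] [wM _ _] _ _] [_ _ a1]] := ten.
have inW v : v \in [:: u; w] -> v \in N ++ M.
  by rewrite !inE mem_cat => /orP[]/eqP->; rewrite ?uN ?wM ?orbT.
have [//|x [_ ltx _ xE _]] := fresh_vertex (L := 0) (bound (N ++ M)) (sub_above inW a1)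
  (_ : forall z, z \in [::] -> z < 0) (splittable_pair u w) (splittable_nil s A).
have lt1 z : z \in N ++ M -> z < x by move=> zN; apply: leq_trans ltx; apply: ltn_bound.
have [||z zN|t [T [TN fT Axt cxt only]]] := tension_apex ten (v := x).
- by rewrite xE ?lt1 ?mem_head // mem_cat uN.
- by rewrite xE ?lt1 ?mem_cat ?wM ?orbT // !inE eqxx !orbT.
- by rewrite xE ?lt1 // orbF !inE => /orP[]/eqP; auto.
have xT : x \notin T by apply/negP => /TN/lt1; rewrite ltnn.
have fx := forces_step fT xT Axt cxt only.
have ltT z : z \in x :: T -> z < x.+1.
  by rewrite inE ltnS => /predU1P[->//|/TN/lt1/ltnW].
have [c2 [u2 [N2 [w2 [M2 ten2]]]]] := tension_exists x.+1.
have lt1' z : z \in N ++ M -> z < x.+1 by move=> /lt1/ltnW.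
have [ec|nec] := eqVneq c2 (~~ c).
  by rewrite ec in ten2; exact: opposite_tensions ten ten2 lt1'.
have ec : c2 = c by case: c2 c nec {ten ten2 fT cxt fx} => [] [].
rewrite {c2 nec}ec in ten2.
have [[[u2N _ _] [w2M _ _] _ _] [_ _ a2]] := ten2.
have inW2 v : v \in [:: u2; w2] -> v \in N2 ++ M2.
  by rewrite !inE mem_cat => /orP[]/eqP->; rewrite ?u2N ?w2M ?orbT.
have ltxx z : z \in [:: x] -> z < x.+1 by rewrite inE => /eqP->.
have [y [xy lty _ yE yx]] := fresh_vertex (bound (N2 ++ M2)) (sub_above inW2 a2) ltxx
  (splittable_pair u2 w2) (splittable1 x).
have lt2 z : z \in N2 ++ M2 -> z < y by move=> zN; apply: leq_trans lty; apply: ltn_bound.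
have notx z : z \in N2 ++ M2 -> z \in [:: x] = false.
  by move=> /a2[xz _]; apply/negP => /ltxx; rewrite ltnNge xz.
have [||z zN|t2 [T2 [TN2 fT2 Ayt cyt only2]]] := tension_apex ten2 (v := y).
- by rewrite yE ?lt2 ?mem_head // mem_cat u2N.
- by rewrite yE ?lt2 ?mem_cat ?w2M ?orbT // !inE eqxx !orbT.
- by rewrite yE ?lt2 // notx // orbF !inE => /orP[]/eqP; auto.
have yT : y \notin T2 by apply/negP => /TN2/lt2; rewrite ltnn.
have fy := forces_step fT2 yT Ayt cyt only2.
have Ayx : A y x by rewrite yx ?mem_head.
have br : bridged (x :: T) (y :: T2) x y.
  move=> a b /ltT ax; rewrite inE => /predU1P[->|/TN2/a2[xb nob]].
    split=> [e|]; first by move: xy; rewrite -e ltnNge -ltnS ax.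
    by rewrite Asym yx // inE => /eqP.
  split=> [e|Aab]; first by move: xb; rewrite -e leqNgt ax.
  by case/negP: (nob a ax); rewrite Asym.
have [cyx|cyx] := eqVneq (col y x) (~~ c).
  by apply: forces_clash fx fy _ _ br; rewrite 1?Asym // col_sym.
have ten3 : tension (~~ c) 0 y (y :: T2) x (x :: T).
  do 2!split=> //.
  - by case: (col y x) c cyx {ten ten2 fT cxt fx fT2 cyt fy} => [] [].
  - by apply/negP => xin; have [] := br x x (mem_head _ _) xin.
  - by apply/negP => yin; have [] := br y y yin (mem_head _ _).
have [c3 [u3 [N3 [w3 [M3 ten4]]]]] := tension_exists y.+1.
have [ec|nec] := eqVneq c3 c.
  rewrite ec -[c]negbK in ten4; apply: opposite_tensions ten3 ten4 _ => z.
  rewrite mem_cat inE => /orP[/predU1P[->|/TN2/lt2/ltnW]|/ltT/leq_trans ->] //.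
  exact: ltnW.
have ec : c3 = ~~ c by case: c3 c nec {ten ten2 ten3 ten4 fT cxt fx fT2 cyt fy cyx} => [] [].
rewrite ec in ten4; apply: opposite_tensions ten ten4 _ => z /lt1' zx.
by apply: leq_trans zx _; apply: leqW.
Qed.

End Refutation.

Theorem theorem1p4 (s : nat) (hs : 2 <= s) :
  exists G : sgraph,
    arrows 2 G (complete 3) /\ ~ arrows 2 (blowup G s) (blowup (complete 3) 2).
Proof.
have Asym := universal_graph_sym s; have Airr := universal_graph_irr s.
have [[m noK]|allK] := EM (exists m, forall k, ~ triangle_free_colouring (universal_graph s) m k).
  exact: (initial_graph_theorem Asym Airr (@universal_graph_splittable s) noK).
have [m|k kP] := triangle_free_limit (A := universal_graph s).
  by apply: contrapT => /forallNP noK; apply: allK; exists m.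
exfalso; apply: (@no_avoiding_colouring s (universal_graph s) (unordered k)) => //.
- exact: unordered_sym.
- move=> x y z Axy Axz Ayz; pose m := (maxn x (maxn y z)).+1.
  have [[xm ym] zm] : (x < m /\ y < m) /\ z < m by rewrite !ltnS !leq_max !leqnn ?orbT.
  exact: (unordered_no_mono Asym Airr (kP m) xm ym zm Axy Axz Ayz).
- exact: universal_graph_extension.
Qed.
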